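(* Let $\mathcal{H}$ be a complex separable Hilbert space and let $(T_1,T_2)$ be a toral $2$-isometric operator-valued weighted shift with invertible weights $\{W_I^{(j)}:j=1,2\}_{I\in\mathbb{Z}_+^2}$ belonging to the class $\ell^2_{IWP}(\mathcal{H})$. Set $A=(W_{0,0}^{(1)})^2-I$ and $B=(W_{0,0}^{(2)})^2-I$. Then, for each $(m,n)\in\mathbb{Z}_+^2$, $$W_{m,n}^{(1)}=\sqrt{(m+1)A+nB+I}\,\Big(\sqrt{mA+nB+I}\Big)^{-1}$$ and $$W_{m,n}^{(2)}=\sqrt{(n+1)B+mA+I}\,\Big(\sqrt{mA+nB+I}\Big)^{-1}.$$
   Context: $\mathbb{Z}_+$ is the set of nonnegative integers, $B(\mathcal{H})$ the algebra of bounded linear operators on $\mathcal{H}$. $\ell^2_{\mathbb{Z}_+^2}(\mathcal{H})=\bigoplus_{(m,n)\in\mathbb{Z}_+^2}\mathcal{H}\cong\ell^2(\mathbb{Z}_+^2)\otimes\mathcal{H}$, with $e_{m,n}\otimes h$ denoting the element having $h$ in coordinate $(m,n)$ and $0$ elsewhere. The operator-valued weighted shift with weights $W^{(j)}_{m,n}\in B(\mathcal{H})$ is the pair $(T_1,T_2)$ with $T_1(e_{m,n}\otimes h)=e_{m+1,n}\otimes W^{(1)}_{m,n}h$ and $T_2(e_{m,n}\otimes h)=e_{m,n+1}\otimes W^{(2)}_{m,n}h$. For $(m,n)\in\mathbb{Z}_+^2$ define $\mathcal{P}_{m,n}=W_{m-1,n}^{(1)}W_{m-2,n}^{(1)}\cdots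 W_{0,n}^{(1)}W_{0,n-1}^{(2)}\cdots W_{0,0}^{(2)}$, with $\mathcal{P}_{0,0}=I$. The class $\ell^2_{IWP}(\mathcal{H})$ consists of the operator-valued weighted shifts on $\ell^2_{\mathbb{Z}_+^2}(\mathcal{H})$ with all weights invertible in $B(\mathcal{H})$ and such that $\mathcal{P}_{m,n}$ is positive for every $(m,n)\in\mathbb{Z}_+^2$. A commuting pair $(T_1,T_2)$ of bounded operators is a toral $2$-isometry if $I-T_i^*T_i-T_j^*T_j+T_j^*T_i^*T_iT_j=0$ for all $i,j\in\{1,2\}$ (including $i=j$). *)

(* Defs.v *)
From HB Require Import structures.
From mathcomp Require Import all_boot all_order all_algebra.
From mathcomp Require Import complex.
From mathcomp Require Import ring lra.
From mathcomp Require Import all_classical all_reals all_analysis.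
Set Implicit Arguments. Unset Strict Implicit. Unset Printing Implicit Defensive.
Import Order.TTheory GRing.Theory Num.Theory.
Import numFieldNormedType.Exports.
Local Open Scope classical_set_scope.
Local Open Scope complex_scope.
Local Open Scope ring_scope.

(* The scalars are R[i] for a realType R. [inner] is linear in its first
   argument and conjugate-linear in the second; the norm of a normedModType
   over R[i] takes its (real) values in R[i]. *)
HB.mixin Record NormedModule_isHilbert (R : realType) H
    & NormedModule R[i] H := {
  inner : {dot H for (@Num.conj R[i])} ;
  inner_normE : forall x : H, (inner : H -> H -> R[i]) x x = `|x| ^+ 2
}.
#[short(type="hilbertType")]
HB.structure Definition Hilbert (R : realType) :=
  {H of CompleteNormedModule R[i] H & NormedModule_isHilbert R H}.

Section dot_norm.
Variables (C : numClosedFieldType) (U : lmodType C) (form : {dot U for @Num.conj C}).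
Local Notation norm u := (sqrtC (form u u)).

Lemma dot_normD u v : norm (u + v) <= norm u + norm v.
Proof.
have [->|u0] := eqVneq u 0; first by rewrite add0r lerDr sqrt_dnorm_ge0.
have [->|v0] := eqVneq v 0; first by rewrite addr0 lerDl sqrt_dnorm_ge0.
have a0 : 0 < norm u by rewrite sqrt_dnorm_gt0.
have b0 : 0 < norm v by rewrite sqrt_dnorm_gt0.
rewrite -(@ler_pXn2r _ 2) ?nnegrE ?addr_ge0 ?sqrt_dnorm_ge0//.
rewrite sqrtCK dnormD/= sqrrD !sqrtCK [leRHS]addrAC lerD2l.
have := dnorm_ge0 form (norm v *: u - norm u *: v).
set a := norm u in a0 *; set b := norm v in b0 *; set d := form u v.
have ua : form u u = a ^+ 2 by rewrite sqrtCK.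
have vb : form v v = b ^+ 2 by rewrite sqrtCK.
have dab : form (b *: u) (a *: v) = a * b * d.
  by rewrite linearZr_LR linearZl_LR/= -[LHS]/(_ * _) geC0_conj 1?ltW// mulrA.
rewrite dnormB/= dab.
have -> : form (b *: u) (b *: u) = a ^+ 2 * b ^+ 2.
  rewrite linearZr_LR linearZl_LR/= -[LHS]/(_ * _) geC0_conj 1?ltW// ua; ring.
have -> : form (a *: v) (a *: v) = a ^+ 2 * b ^+ 2.
  rewrite linearZr_LR linearZl_LR/= -[LHS]/(_ * _) geC0_conj 1?ltW// vb; ring.
rewrite rmorphM/= (@geC0_conj _ (a * b)); last by rewrite mulr_ge0// ltW.
rewrite -(mulrDr (a * b)) subr_ge0.
rewrite [leRHS](_ : _ = a * b * (a * b *+ 2)); last by rewrite mulr2n; ring.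
by rewrite ler_pM2l// mulr_gt0.
Qed.

Lemma dot_normZ c u : norm (c *: u) = `|c| * norm u.
Proof. by rewrite dnormZ sqrtCM ?nnegrE ?exprn_ge0 ?dnorm_ge0// exprCK. Qed.

End dot_norm.

Section rsum.
Variables (R : realType) (I : choiceType).
Implicit Types a b : I -> R.

Definition rsummable a := summable [set: I] (EFin \o a).
(* Sum of an absolutely summable real family: for every summable a this is the
   unconditional sum, computed as the difference of its positive and negative
   parts since \esum is only meaningful for nonnegative families. *)
Definition rsum a : R :=
  fine (\esum_(i in [set: I]) (EFin \o a)^\+ i)%E
  - fine (\esum_(i in [set: I]) (EFin \o a)^\- i)%E.

Lemma rsummable_le a b : (forall i, `|a i| <= b i) -> rsummable b -> rsummable a.
Proof.
move=> ab; apply: le_lt_trans; apply: le_esum => i _ /=.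
by rewrite lee_fin (le_trans (ab i))// ler_norm.
Qed.

Lemma rsummableD a b : rsummable a -> rsummable b -> rsummable (a \+ b).
Proof. exact: summableD. Qed.

Lemma esumZ (k : R) a : 0 <= k -> (forall i, 0 <= a i) ->
  (\esum_(i in [set: I]) (k * a i)%:E = k%:E * \esum_(i in [set: I]) (a i)%:E)%E.
Proof.
move=> k0 a0; rewrite /esum -ereal_supZl//; last first.
  by apply/set0P; exists 0%E, set0; [exact: fsets_set0|rewrite fsbig_set0].
congr ereal_sup; apply/seteqP; split=> x /=.
  move=> [A Af <-]; exists (\sum_(i \in A) (a i)%:E)%E; first by exists A.
  by rewrite ge0_mule_fsumr// => i; rewrite lee_fin.
move=> [_ [A Af <-] <-]; exists A => //.
by rewrite ge0_mule_fsumr// => i; rewrite lee_fin.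
Qed.

Lemma rsummableZ (k : R) a : rsummable a -> rsummable (fun i => k * a i).
Proof.
move=> sa; rewrite /rsummable /summable.
rewrite (_ : (\esum_(_ in _) _)%E = (\esum_(i in [set: I]) (`|k| * `|a i|)%:E)%E).
  by rewrite esumZ// lte_mul_pinfty// lee_fin.
by apply: eq_esum => i _ /=; rewrite normrM.
Qed.

Lemma rsum_diff a b : rsummable a -> rsummable b ->
  (forall i, 0 <= a i) -> (forall i, 0 <= b i) ->
  rsum (fun i => a i - b i) =
    fine (\esum_(i in [set: I]) (a i)%:E)%E - fine (\esum_(i in [set: I]) (b i)%:E)%E.
Proof.
move=> sa sb a0 b0; rewrite /rsum.
have sab : summable [set: I] (EFin \o (fun i => a i - b i)) by exact: (summableB sa sb).
have ff f : (forall i, 0 <= f i)%E -> summable [set: I] f ->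
    (\esum_(i in [set: I]) f i)%E \is a fin_num.
  move=> f0; rewrite summableE.
  by rewrite (eq_esum (b := f))// => i _; rewrite gee0_abs.
rewrite -!fineB ?ff//; try by [exact: summable_funepos|exact: summable_funeneg|
  move=> i; rewrite lee_fin].
congr fine.
by apply: (esumB sa sb) => i _; rewrite lee_fin.
Qed.

Lemma rsum_ge0E a : (forall i, 0 <= a i) ->
  rsum a = fine (\esum_(i in [set: I]) (a i)%:E)%E.
Proof.
move=> a0; rewrite /rsum [X in _ - fine X]esum1 ?subr0.
  by congr fine; apply: eq_esum => i _; rewrite funeposE/= -EFin_max max_l.
by move=> i _; rewrite funenegE/=; apply/max_idPr; rewrite lee_fin oppr_le0.
Qed.

Lemma rsum_ge0_fin a : (forall i, 0 <= a i) -> rsummable a ->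
  ((rsum a)%:E = \esum_(i in [set: I]) (a i)%:E)%E.
Proof.
move=> a0 sa; rewrite rsum_ge0E// fineK//.
rewrite ge0_fin_numE; last by apply: esum_ge0 => i _; rewrite lee_fin.
apply: le_lt_trans sa; apply: le_esum => i _ /=; by rewrite lee_fin ler_norm.
Qed.

Definition rpos a i := Num.max (a i) 0.
Definition rneg a i := Num.max (- a i) 0.
Lemma rposneg a i : a i = rpos a i - rneg a i.
Proof.
rewrite /rpos /rneg; case: (leP 0 (a i)) => h.
  by rewrite max_r ?oppr_le0// subr0.
by rewrite max_l ?oppr_ge0 1?ltW// opprK add0r.
Qed.
Lemma rpos_ge0 a i : 0 <= rpos a i. Proof. by rewrite le_max lexx orbT. Qed.
Lemma rneg_ge0 a i : 0 <= rneg a i. Proof. by rewrite le_max lexx orbT. Qed.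
Lemma rpos_summable a : rsummable a -> rsummable (rpos a).
Proof.
apply: le_lt_trans; apply: le_esum => i _ /=; rewrite lee_fin ger0_norm ?rpos_ge0//.
by rewrite ge_max ler_norm normr_ge0.
Qed.
Lemma rneg_summable a : rsummable a -> rsummable (rneg a).
Proof.
apply: le_lt_trans; apply: le_esum => i _ /=; rewrite lee_fin ger0_norm ?rneg_ge0//.
by rewrite ge_max -normrN ler_norm normr_ge0.
Qed.

Lemma rsumD a b : rsummable a -> rsummable b ->
  rsum (fun i => a i + b i) = rsum a + rsum b.
Proof.
move=> sa sb.
have -> : (fun i => a i + b i) =
   (fun i => (rpos a i + rpos b i) - (rneg a i + rneg b i)).
  by apply/funext => i; rewrite {1}(rposneg a) {1}(rposneg b) addrACA opprD.
have E c : c = (fun i => rpos c i - rneg c i) by apply/funext => i; exact: rposneg.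
rewrite {3}(E a) {3}(E b).
have ap := rpos_summable sa; have an := rneg_summable sa.
have bp := rpos_summable sb; have bn := rneg_summable sb.
have P c := rpos_ge0 c; have N c := rneg_ge0 c.
rewrite !rsum_diff//; try by [exact: rsummableD | move=> i; rewrite addr_ge0].
have F c d : rsummable c -> rsummable d -> (forall i, 0 <= c i) -> (forall i, 0 <= d i) ->
  fine (\esum_(i in [set: I]) (c i + d i)%:E)%E =
  fine (\esum_(i in [set: I]) (c i)%:E)%E + fine (\esum_(i in [set: I]) (d i)%:E)%E.
  move=> sc sd c0 d0.
  apply: EFin_inj.
  rewrite EFinD -!rsum_ge0E//; last by move=> i; rewrite addr_ge0.
  rewrite [LHS]rsum_ge0_fin; [|by move=> i; exact: addr_ge0|exact: rsummableD].
  by rewrite !rsum_ge0_fin// -esumD// => i _; rewrite lee_fin.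
by rewrite (F _ _ ap bp (P a) (P b)) (F _ _ an bn (N a) (N b)) opprD addrACA.
Qed.

Lemma rsummableN a : rsummable a -> rsummable (fun i => - a i).
Proof.
move=> /(rsummableZ (-1)); congr rsummable.
by apply/funext => i; rewrite mulN1r.
Qed.

Lemma rsumN a : rsummable a -> rsum (fun i => - a i) = - rsum a.
Proof.
move=> sa; apply/eqP; rewrite -addr_eq0 -rsumD//; last exact: rsummableN.
under eq_fun do rewrite addNr.
by rewrite rsum_ge0E// esum1.
Qed.

Lemma rsumZ k a : rsummable a -> rsum (fun i => k * a i) = k * rsum a.
Proof.
have H c b : 0 <= c -> rsummable b -> rsum (fun i => c * b i) = c * rsum b.
  move=> c0 sb.
  have E d : d = (fun i => rpos d i - rneg d i).
    by apply/funext => i; exact: rposneg.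
  have -> : (fun i => c * b i) = (fun i => c * rpos b i - c * rneg b i).
    by apply/funext => i; rewrite {1}(rposneg b) mulrBr.
  have bp := rpos_summable sb; have bn := rneg_summable sb.
  have P := rpos_ge0 b; have N := rneg_ge0 b.
  rewrite {3}(E b) !rsum_diff//; try by
    [exact: rsummableZ|move=> i; exact: mulr_ge0].
  by rewrite !esumZ// !fineM ?mulrBr// -rsum_ge0_fin.
move=> sa; have [k0|k0] := leP 0 k; first exact: H.
rewrite -[k]opprK; under eq_fun do rewrite mulNr.
by rewrite rsumN ?H ?oppr_ge0 ?mulNr 1?ltW//; exact: rsummableZ.
Qed.

Lemma rsum_ge0 a : (forall i, 0 <= a i) -> 0 <= rsum a.
Proof.
move=> a0; rewrite rsum_ge0E// fine_ge0// esum_ge0// => i _.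
by rewrite lee_fin.
Qed.

Lemma rsum_eq0 a : (forall i, 0 <= a i) -> rsummable a -> rsum a = 0 ->
  forall i, a i = 0.
Proof.
move=> a0 sa ra i; apply/eqP; rewrite eq_le a0 andbT -lee_fin.
rewrite -[leRHS]/(0%:E) -ra rsum_ge0_fin//.
apply: esum_ge; exists [set i]; first by split.
by rewrite fsbig_set1.
Qed.

End rsum.

Section csum.
Variables (R : realType) (I : choiceType).
Implicit Types a b : I -> R[i].

Definition csummable a :=
  rsummable (fun i => complex.Re (a i)) /\ rsummable (fun i => complex.Im (a i)).
Definition csum a : R[i] :=
  rsum (fun i => complex.Re (a i)) +i* rsum (fun i => complex.Im (a i)).

Lemma csumD a b : csummable a -> csummable b ->
  csum (fun i => a i + b i) = csum a + csum b.
Proof.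
move=> [a1 a2] [b1 b2]; rewrite /csum; apply/eqP; rewrite eq_complex/=.
rewrite -!rsumD//; apply/andP; split; apply/eqP; congr rsum; apply/funext => i.
  by rewrite raddfD.
by rewrite raddfD.
Qed.

Lemma csumZ k a : csummable a -> csum (fun i => k * a i) = k * csum a.
Proof.
case: k => x y [a1 a2]; rewrite /csum; apply/eqP; rewrite eq_complex/=.
rewrite -!rsumZ//; apply/andP; split; apply/eqP.
  rewrite -rsumN; last exact: rsummableZ.
  rewrite -rsumD; [|exact: rsummableZ|by apply: rsummableN; exact: rsummableZ].
  by congr rsum; apply/funext => i /=; case: (a i).
rewrite -rsumD; [|exact: rsummableZ|exact: rsummableZ].
by congr rsum; apply/funext => i /=; case: (a i).
Qed.

Lemma csumJ a : csummable a ->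
  csum (fun i => (a i)^*)%C = ((csum a)^*)%C.
Proof.
move=> [a1 a2]; rewrite /csum; apply/eqP; rewrite eq_complex/=.
rewrite -!rsumN//; apply/andP; split; apply/eqP.
  by congr rsum; apply/funext => i /=; case: (a i).
by congr rsum; apply/funext => i /=; case: (a i).
Qed.

Lemma csum_ge0 a : (forall i, 0 <= a i) ->
  csum a = (rsum (fun i => complex.Re (a i)))%:C.
Proof.
move=> a0; rewrite /csum; apply/eqP; rewrite eq_complex/= eqxx/=.
rewrite rsum_ge0E ?esum1// => i; by move/ger0_Im: (a0 i) => ->.
Qed.

End csum.

Section l2.
Variables (R : realType) (I : choiceType) (H : hilbertType R).

Let CM (x y : R) : (x * y)%:C = x%:C * y%:C. Proof. exact: rmorphM. Qed.
Let CD (x y : R) : (x + y)%:C = x%:C + y%:C. Proof. exact: rmorphD. Qed.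

Definition sqnorm (h : H) : R := complex.Re (`|h| ^+ 2).

Lemma sqnormE (h : H) : (sqnorm h)%:C = `|h| ^+ 2.
Proof. by apply: RRe_real; rewrite ger0_real// exprn_ge0. Qed.

Lemma sqnorm_ge0 (h : H) : 0 <= sqnorm h.
Proof. by rewrite -ler0c sqnormE exprn_ge0. Qed.

Lemma sqnormZ (c : R[i]) (h : H) : sqnorm (c *: h) = complex.Re (`|c| ^+ 2) * sqnorm h.
Proof.
apply: complexI; rewrite CM !sqnormE normrZ exprMn.
by rewrite (@RRe_real _ (`|c| ^+ 2))// ger0_real// exprn_ge0.
Qed.

Lemma sqnormD (x y : H) :
  sqnorm (x + y) = sqnorm x + sqnorm y + 2 * complex.Re (inner x y).
Proof.
apply: complexI; rewrite !CD !CM !sqnormE.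
rewrite -!inner_normE dnormD/=; congr (_ + _).
by rewrite -[LHS]/(_ + (_^*)%C) addcJ rmorph_nat.
Qed.

Lemma sqnormB (x y : H) :
  sqnorm (x - y) = sqnorm x + sqnorm y - 2 * complex.Re (inner x y).
Proof. by rewrite sqnormD linearNr/= raddfN/= /sqnorm normrN mulrN. Qed.

Lemma sqnormD_le (x y : H) : sqnorm (x + y) <= 2 * sqnorm x + 2 * sqnorm y.
Proof.
have := sqnorm_ge0 (x - y); rewrite sqnormB sqnormD; lra.
Qed.

Lemma Re_inner_le (x y : H) : `|complex.Re (inner x y)| <= sqnorm x + sqnorm y.
Proof.
rewrite ler_norml; apply/andP.
have := sqnorm_ge0 (x - y); have := sqnorm_ge0 (x + y); rewrite sqnormB sqnormD.
have := sqnorm_ge0 x; have := sqnorm_ge0 y; split; lra.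
Qed.

Lemma Im_inner_le (x y : H) : `|complex.Im (inner x y)| <= sqnorm x + sqnorm y.
Proof.
have := Re_inner_le x ('i%C *: y).
rewrite linearZr_LR/= sqnormZ.
have -> : complex.Re (`|'i%C : R[i]| ^+ 2) = 1.
  by rewrite -add_Re2_Im2/= expr0n expr1n add0r.
rewrite mul1r; congr (_ <= _).
by case: (inner x y) => p q /=; rewrite mul0r mulN1r opprK add0r.
Qed.

(* l2 I H is the Hilbert direct sum of copies of H indexed by I: the families
   (f i) with \sum_i `|f i|^2 < +oo, with inner product \sum_i <f i, g i>. *)
Definition l2_pred : {pred I -> H} :=
  mem [set f : I -> H | rsummable (fun i => sqnorm (f i))].

Lemma l2_submod_closed : submod_closed l2_pred.
Proof.
split.
  rewrite inE/= /rsummable /summable.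
  rewrite esum1 ?ltry// => i _ /=.
  by rewrite /sqnorm normr0 expr0n normr0.
move=> c u v; rewrite !inE/= => su sv.
apply: (@rsummable_le _ _ _
  (fun i => 2 * (complex.Re (`|c| ^+ 2) * sqnorm (u i)) + 2 * sqnorm (v i))).
  by move=> i; rewrite ger0_norm ?sqnorm_ge0// -sqnormZ; exact: sqnormD_le.
by apply: rsummableD; do ?exact: rsummableZ; apply: rsummableZ; exact: rsummableZ.
Qed.

HB.instance Definition _ := GRing.isSubmodClosed.Build _ _ l2_pred l2_submod_closed.

Record l2 := L2 { l2_fun :> I -> H ; l2P : l2_fun \in l2_pred }.
HB.instance Definition _ := [isSub for l2_fun].
HB.instance Definition _ := [Choice of l2 by <:].
HB.instance Definition _ := [SubChoice_isSubLmodule of l2 by <:].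

Definition l2_inner (f g : l2) : R[i] := csum (fun i => inner (f i) (g i)).

Lemma l2_summable (f : l2) : rsummable (fun i => sqnorm (f i)).
Proof. by have := l2P f; rewrite inE. Qed.

Lemma l2_inner_summable (f g : l2) : csummable (fun i => inner (f i) (g i)).
Proof.
have s := rsummableD (l2_summable f) (l2_summable g).
by split; apply: rsummable_le s => i; [exact: Re_inner_le|exact: Im_inner_le].
Qed.

Lemma l2_innerDl (f g h : l2) : l2_inner (f + g) h = l2_inner f h + l2_inner g h.
Proof.
rewrite /l2_inner -csumD; [|exact: l2_inner_summable..].
by congr csum; apply/funext => i; rewrite -linearDl.
Qed.

Lemma l2_innerZl c (f h : l2) : l2_inner (c *: f) h = c * l2_inner f h.
Proof.
rewrite /l2_inner -csumZ; last exact: l2_inner_summable.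
by congr csum; apply/funext => i; rewrite -linearZl_LR.
Qed.

Lemma l2_innerC (f g : l2) : l2_inner f g = Num.conj (l2_inner g f).
Proof.
rewrite -[RHS]/((l2_inner g f)^*%C) /l2_inner -csumJ; last exact: l2_inner_summable.
congr csum; apply/funext => i.
by rewrite hermC expr0 mul1r.
Qed.

Lemma l2_innerE (f : l2) : l2_inner f f = (rsum (fun i => sqnorm (f i)))%:C.
Proof.
rewrite /l2_inner csum_ge0//.
by congr ((rsum _)%:C); apply/funext => i; rewrite inner_normE.
Qed.

Lemma l2_inner_gt0 (f : l2) : f != 0 -> 0 < l2_inner f f.
Proof.
move=> f0; rewrite lt_neqAle l2_innerE ler0c rsum_ge0 ?andbT; last first.
  by move=> i; exact: sqnorm_ge0.
apply: contra f0; rewrite eq_sym => /eqP/complexI r0.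
apply/eqP/val_inj/funext => i /=.
have := rsum_eq0 (fun i => sqnorm_ge0 (f i)) (l2_summable f) r0 i.
move=> /(congr1 (real_complex R)); rewrite sqnormE => /eqP.
by rewrite expf_eq0/= normr_eq0 => /eqP.
Qed.

Let l2_inner_zmodl u' : zmod_morphism (l2_inner ^~ u').
Proof.
by move=> x y /=; rewrite l2_innerDl -scaleN1r l2_innerZl mulN1r.
Qed.
Let l2_inner_zmodr u : zmod_morphism (l2_inner u).
Proof.
move=> x y /=.
rewrite l2_innerC l2_inner_zmodl rmorphB.
by congr (_ - _); rewrite [RHS]l2_innerC.
Qed.
Let l2_inner_scalel u' : scalable_for *%R (l2_inner ^~ u').
Proof. by move=> c x /=; rewrite l2_innerZl. Qed.
Let l2_inner_scaler u : scalable_for (Num.conj \; *%R) (l2_inner u).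
Proof.
move=> c x /=; rewrite l2_innerC l2_innerZl rmorphM.
by congr (_ * _); rewrite [RHS]l2_innerC.
Qed.
HB.instance Definition _ := @isBilinear.Build R[i] l2 l2 R[i] *%R (Num.conj \; *%R)
  l2_inner l2_inner_zmodl l2_inner_zmodr l2_inner_scalel l2_inner_scaler.
Let l2_inner_herm x y : l2_inner x y = (-1) ^+ false * Num.conj (l2_inner y x).
Proof. by rewrite expr0 mul1r l2_innerC. Qed.
HB.instance Definition _ := @isHermitianSesquilinear.Build R[i] l2 false
  (@Num.conj R[i]) l2_inner l2_inner_herm.
HB.instance Definition _ := @isDotProduct.Build R[i] l2 l2_inner l2_inner_gt0.
End l2.

Section l2_hilbert.
Variables (R : realType) (I : choiceType) (H : hilbertType R).
Local Notation l2 := (l2 I H).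

Let l2_norm_eq0 (f : l2) : sqrtC (l2_inner f f) = 0 -> f = 0.
Proof. by move/eqP; rewrite sqrt_dnorm_eq0 => /eqP. Qed.

HB.instance Definition _ := @Lmodule_isNormed.Build R[i] l2
  (fun f => sqrtC (l2_inner f f)) (@dot_normD _ l2 (@l2_inner R I H))
  (@dot_normZ _ l2 (@l2_inner R I H)) l2_norm_eq0.

Lemma l2_inner_normE (f : l2) : l2_inner f f = `|f| ^+ 2.
Proof. by rewrite sqrtCK. Qed.

Lemma l2_sqnormE (f : l2) : `|f| ^+ 2 = (rsum (fun i => sqnorm (f i)))%:C.
Proof. by rewrite -l2_inner_normE l2_innerE. Qed.

Lemma l2_coord_le (f : l2) i : `|f i| <= `|f|.
Proof.
rewrite -(@ler_pXn2r _ 2) ?nnegrE// l2_sqnormE -sqnormE lecR -lee_fin.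
rewrite rsum_ge0_fin; [|by move=> j; exact: sqnorm_ge0|exact: l2_summable].
apply: esum_ge; exists [set i]; first by split.
by rewrite fsbig_set1.
Qed.

Lemma l2_sum_le (f : l2) (A : set I) : finite_set A ->
  (\sum_(i \in A) (sqnorm (f i))%:E <= (rsum (fun i => sqnorm (f i)))%:E)%E.
Proof.
move=> fA.
rewrite rsum_ge0_fin; [|by move=> j; exact: sqnorm_ge0|exact: l2_summable].
by apply: esum_ge; exists A.
Qed.

Let near_seq (F : set_system l2) (FF : Filter F) (P : I -> l2 -> Prop) (s : seq I) :
  (forall i, \forall f \near F, P i f) ->
  \forall f \near F, forall i, i \in s -> P i f.
Proof.
move=> FP; elim: s => [|i s IH]; first by apply: nearW.
have Pi := FP i; near=> f => j; rewrite inE => /predU1P[->|].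
  by near: f.
by move: j; near: f.
Unshelve. all: by end_near. Qed.

Let l2_complete (F : set_system l2) : ProperFilter F -> cauchy F -> cvg F.
Proof.
move=> FF /cauchyP Fc.
have cc i : cvg ((fun f : l2 => f i) @ F).
  apply: cauchy_cvg; apply: cauchy_exP => e /Fc[x Fx]; exists (x i) => /=.
  apply: filterS Fx => f /=; rewrite -!ball_normE/=; apply: le_lt_trans.
  exact: (l2_coord_le (x - f)).
pose g i := lim ((fun f : l2 => f i) @ F).
have bound (e : R) (x : l2) : 0 < e -> F (ball x e%:C) ->
    (\esum_(i in [set: I]) (sqnorm (g i - x i))%:E <= (4 * e ^+ 2)%:E)%E.
  move=> e0 Fx; apply: ge_ereal_sup => _ [A [fA _] <-].
  pose s : seq I := finmap.enum_fset (fset_set A).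
  pose N : R := (size s)%:R + 1.
  have N1 : 1 <= N by rewrite lerDr.
  have d0 : 0 < (e / N)%:C by rewrite ltcR divr_gt0// (lt_le_trans _ N1).
  have gf i : \forall f \near F, `|g i - (f : l2) i| < (e / N)%:C.
    by have /cvgrPdist_lt/(_ _ d0) := cc i.
  have [f [fx fg]] : exists f : l2, ball x e%:C f /\
      forall i, i \in s -> `|g i - f i| < (e / N)%:C.
    exact: filter_ex (filterI Fx (near_seq _ s gf)).
  have fxe : rsum (fun i => sqnorm ((f - x) i)) <= e ^+ 2.
    rewrite -lecR -l2_sqnormE rmorphXn/= lerXn2r ?nnegrE ?ler0c ?(ltW e0)//.
    by move: fx; rewrite -ball_normE/= distrC => /ltW.
  have := l2_sum_le (f - x) fA; rewrite !fsbig_finite//= !sumEFin !lee_fin => fxA.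
  have -> : 4 * e ^+ 2 = 2 * e ^+ 2 + 2 * e ^+ 2 by ring.
  apply: (@le_trans _ _ (\sum_(i <- s) (2 * (e / N) ^+ 2 + 2 * sqnorm ((f - x) i)))).
    rewrite big_seq [leRHS]big_seq; apply: ler_sum => i iA.
    have -> : g i - x i = (g i - f i) + (f - x) i by rewrite /= addrA subrK.
    apply: (le_trans (sqnormD_le _ _)); rewrite lerD2r ler_pM2l//.
    rewrite -lecR sqnormE rmorphXn/= lerXn2r ?nnegrE ?(ltW d0)//.
    by rewrite ltW// fg.
  rewrite big_split/= -!mulr_sumr lerD// ler_pM2l//; last exact: le_trans fxA fxe.
  rewrite big_const_seq count_predT iter_addr_0 -mulr_natr.
  rewrite (_ : _ * _ = e ^+ 2 * ((N ^-1) ^+ 2 * (size s)%:R)); last by ring.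
  rewrite ler_piMr ?sqr_ge0// exprVn ler_pdivrMl; last first.
    by rewrite exprn_gt0// (lt_le_trans _ N1).
  rewrite mulr1; apply: (@le_trans _ _ N); first by rewrite lerDl.
  by rewrite expr2 ler_peMl// (le_trans _ N1).
have gP : g \in @l2_pred R I H.
  have [x Fx] := Fc 1%:C ltr01.
  rewrite (_ : g = (g - (x : I -> H)) + x); last by rewrite subrK.
  apply: rpredD; last exact: l2P.
  rewrite inE/= /rsummable /summable.
  apply: le_lt_trans (ltry (4 * 1 ^+ 2)); apply: le_trans (bound 1 x ltr01 Fx).
  by apply: le_esum => i _ /=; rewrite ger0_norm// sqnorm_ge0.
apply/cvg_ex; exists (L2 gP); apply/fcvgrPdist_lt => e e0.
have [r r0 ->] : exists2 r : R, 0 < r & e = r%:C.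
  exists (complex.Re e); last by rewrite RRe_real// ger0_real// ltW.
  by rewrite -ltcR RRe_real// ger0_real// ltW.
have r40 : 0 < r / 4 by rewrite divr_gt0.
have [x Fx] : exists x, F (ball x (r / 4)%:C) by apply: Fc; rewrite ltcR.
have Gx : `|L2 gP - x| <= (2 * (r / 4))%:C.
  have r2 : 0 <= (2 * (r / 4))%:C by rewrite ler0c mulr_ge0// ltW.
  rewrite -(@ler_pXn2r _ 2) ?nnegrE ?normr_ge0 ?r2// l2_sqnormE.
  have -> : (2 * (r / 4))%:C ^+ 2 = (4 * (r / 4) ^+ 2)%:C.
    by rewrite !expr2 -(rmorphM (real_complex R)); congr (_%:C); ring.
  rewrite lecR -lee_fin rsum_ge0_fin; last exact: l2_summable.
    exact: bound r40 Fx.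
  by move=> j; exact: sqnorm_ge0.
apply: filterS Fx => f; rewrite -ball_normE/= => xf.
have -> : L2 gP - f = (L2 gP - x) + (x - f) by rewrite addrA subrK.
apply: (le_lt_trans (ler_normD _ _)); apply: (lt_le_trans (ler_ltD Gx xf)).
rewrite -rmorphD/= lecR; lra.
Qed.

HB.instance Definition _ := @Uniform_isComplete.Build l2 l2_complete.
HB.instance Definition _ := @NormedModule_isHilbert.Build R l2
  (@l2_inner R I H) l2_inner_normE.
End l2_hilbert.


Section l2_delta.
Variables (R : realType) (I : choiceType) (H : hilbertType R).

Lemma l2_delta_subproof (i : I) (h : H) :
  (fun j => if j == i then h else 0) \in @l2_pred R I H.
Proof.
rewrite inE/= /rsummable /summable.
rewrite (eq_esum (b := fun j =>
    if j \in [set i] then (sqnorm h)%:E else 0%E)); last first.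
  move=> j _ /=; have [->|/eqP ji] := eqVneq j i.
    by rewrite mem_set// ger0_norm// sqnorm_ge0.
  by rewrite memNset// /sqnorm normr0 expr0n normr0.
by rewrite -esum_mkcond esum_set1 ?ltry// lee_fin sqnorm_ge0.
Qed.

(* e_i \otimes h *)
Definition l2_delta (i : I) (h : H) : l2 I H := L2 (l2_delta_subproof i h).

End l2_delta.

Section bounded_operators.
Variables (R : realType) (H : hilbertType R).

Record bop := BOp {
  bop_fun :> H -> H ;
  bop_linear : linear bop_fun ;
  bop_bounded : exists M : R, forall x, `|bop_fun x| <= M%:C * `|x|
}.

HB.instance Definition _ := gen_eqMixin bop.
HB.instance Definition _ := gen_choiceMixin bop.
HB.instance Definition _ (T : bop) :=
  GRing.isLinear.Build R[i] H H *:%R T (bop_linear T).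

Lemma bop_eqP (S T : bop) : S = T <-> S =1 T.
Proof.
split=> [->//|]; case: S T => [s sl sb] [t tl tb]/= st.
have {}st : s = t by apply/funext.
by rewrite st in sl sb *; congr BOp; exact: Prop_irrelevance.
Qed.

Let zero_linear : linear (fun _ : H => 0 : H).
Proof. by move=> c x y; rewrite scaler0 addr0. Qed.
Let zero_bounded : exists M : R, forall x : H, `|0 : H| <= M%:C * `|x|.
Proof. by exists 0 => x; rewrite normr0 mul0r. Qed.
Definition bop_zero := BOp zero_linear zero_bounded.

Let opp_linear (T : bop) : linear (fun x => - T x).
Proof. by move=> c x y; rewrite linearP opprD scalerN. Qed.
Let opp_bounded (T : bop) :
  exists M : R, forall x : H, `|- T x| <= M%:C * `|x|.
Proof. by have [M TM] := bop_bounded T; exists M => x; rewrite normrN. Qed.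
Definition bop_opp T := BOp (opp_linear T) (opp_bounded T).

Let add_linear (S T : bop) : linear (fun x => S x + T x).
Proof. by move=> c x y; rewrite !linearP scalerDr addrACA. Qed.
Let add_bounded (S T : bop) :
  exists M : R, forall x : H, `|S x + T x| <= M%:C * `|x|.
Proof.
have [M SM] := bop_bounded S; have [N TN] := bop_bounded T.
exists (M + N) => x; rewrite rmorphD/= mulrDl.
by rewrite (le_trans (ler_normD _ _))// lerD.
Qed.
Definition bop_add S T := BOp (add_linear S T) (add_bounded S T).

Let one_linear : linear (fun x : H => x).
Proof. by []. Qed.
Let one_bounded : exists M : R, forall x : H, `|x| <= M%:C * `|x|.
Proof. by exists 1 => x; rewrite mul1r. Qed.
Definition bop_one := BOp one_linear one_bounded.

Let mul_linear (S T : bop) : linear (fun x => S (T x)).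
Proof. by move=> c x y; rewrite !linearP. Qed.
Let mul_bounded (S T : bop) :
  exists M : R, forall x : H, `|S (T x)| <= M%:C * `|x|.
Proof.
have [M SM] := bop_bounded S; have [N TN] := bop_bounded T.
exists (`|M| * N) => x; apply: (le_trans (SM _)).
apply: (@le_trans _ _ (`|M|%:C * `|T x|)).
  by rewrite ler_wpM2r// lecR ler_norm.
by rewrite rmorphM/= -mulrA ler_wpM2l// ler0c.
Qed.
Definition bop_mul S T := BOp (mul_linear S T) (mul_bounded S T).

Let addA : associative bop_add.
Proof. by move=> S T U; apply/bop_eqP => x /=; rewrite addrA. Qed.
Let addC : commutative bop_add.
Proof. by move=> S T; apply/bop_eqP => x /=; rewrite addrC. Qed.
Let add0 : left_id bop_zero bop_add.
Proof. by move=> T; apply/bop_eqP => x /=; rewrite add0r. Qed.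
Let addN : left_inverse bop_zero bop_opp bop_add.
Proof. by move=> T; apply/bop_eqP => x /=; rewrite addNr. Qed.
HB.instance Definition _ := GRing.isZmodule.Build bop addA addC add0 addN.

Let mulA : associative bop_mul.
Proof. by move=> S T U; apply/bop_eqP. Qed.
Let mul1 : left_id bop_one bop_mul.
Proof. by move=> T; apply/bop_eqP. Qed.
Let mulr1 : right_id bop_one bop_mul.
Proof. by move=> T; apply/bop_eqP. Qed.
Let mulDl : left_distributive bop_mul bop_add.
Proof. by move=> S T U; apply/bop_eqP. Qed.
Let mulDr : right_distributive bop_mul bop_add.
Proof. by move=> S T U; apply/bop_eqP => x /=; rewrite linearD. Qed.
(* A pzRingType: bop is the zero ring when H = 0. *)
HB.instance Definition _ :=
  GRing.Zmodule_isPzRing.Build bop mulA mul1 mulr1 mulDl mulDr.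

(* Exists, by the Riesz representation theorem, and is unique; the default
   value 0 is never used. *)
Definition adjoint (T : bop) : bop :=
  xget 0 [set S : bop | forall x y, inner (T x) y = inner x (S y)].

(* The order of R[i] makes this include that inner (T x) x is real. *)
Definition bop_positive (T : bop) : Prop := forall x, 0 <= inner (T x) x.

(* The positive square root, unique and existing when T is positive; 0 for
   operators without a positive square root. *)
Definition bop_sqrt (T : bop) : bop :=
  xget 0 [set S : bop | bop_positive S /\ S ^+ 2 = T].

Definition is_inverse (T S : bop) : Prop := S * T = 1 /\ T * S = 1.

Definition bop_invertible (T : bop) : Prop := exists S, is_inverse T S.

(* 0 when T is not invertible *)
Definition bop_inv (T : bop) : bop := xget 0 [set S | is_inverse T S].

Definition toral_2isometry (T1 T2 : bop) : Prop :=
  T1 * T2 = T2 * T1 /\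
  forall Ti Tj, [set T1; T2] Ti -> [set T1; T2] Tj ->
    1 - adjoint Ti * Ti - adjoint Tj * Tj
      + adjoint Tj * adjoint Ti * Ti * Tj = 0.

(* \mathcal P_{m,n} = W1_{m-1,n} ... W1_{0,n} W2_{0,n-1} ... W2_{0,0} *)
Fixpoint weight_path0 (W2 : nat -> nat -> bop) (n : nat) : bop :=
  if n is k.+1 then W2 0%N k * weight_path0 W2 k else 1.

Fixpoint weight_path (W1 W2 : nat -> nat -> bop) (m n : nat) : bop :=
  if m is k.+1 then W1 k n * weight_path W1 W2 k n else weight_path0 W2 n.

Definition l2_IWP (W1 W2 : nat -> nat -> bop) : Prop :=
  (forall m n, bop_invertible (W1 m n) /\ bop_invertible (W2 m n)) /\
  (forall m n, bop_positive (weight_path W1 W2 m n)).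

End bounded_operators.

(* Bounded operators T1, T2 are determined by these values, the span of the
   vectors e_{m,n} \otimes h being dense. *)
Definition weighted_shift (R : realType) (H : hilbertType R)
    (W1 W2 : nat -> nat -> bop H) (T1 T2 : bop (l2 (nat * nat)%type H)) : Prop :=
  forall (m n : nat) (h : H),
    T1 (l2_delta (m, n) h) = l2_delta (m.+1, n) (W1 m n h) /\
    T2 (l2_delta (m, n) h) = l2_delta (m, n.+1) (W2 m n h).

Definition separable_space (T : topologicalType) : Prop :=
  exists2 D : set T, countable D & dense D.

(* Main.v *)
Require Import Defs.
From HB Require Import structures.
From mathcomp Require Import all_boot all_order all_algebra.
From mathcomp Require Import complex ring lra.
From mathcomp Require Import all_classical all_reals all_analysis.
Set Implicit Arguments. Unset Strict Implicit. Unset Printing Implicit Defensive.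
Import Order.TTheory GRing.Theory Num.Theory.
Import numFieldNormedType.Exports.
Local Open Scope ring_scope.

(** Write P_{m,n} for the product of the weights along the path from (0,0) to
    (m,n). Commutativity of the two shifts makes this product independent of
    the path ([weight_pathSr]), so each weight is a quotient of two consecutive
    ones: W1_{m,n} = P_{m+1,n} P_{m,n}^-1 and W2_{m,n} = P_{m,n+1} P_{m,n}^-1.
    The theorem therefore amounts to P_{m,n} = sqrt (mA + nB + I).

    To identify the square of P_{m,n}, fix h and follow the orbit of
    e_{0,0} (x) h: it passes through e_{m,n} (x) P_{m,n} h. Evaluated on this
    vector, the three toral identities say that all second differences of
    (m,n) |-> |P_{m,n} h|^2 vanish ([toral_rdot]), so that this function is
    affine in (m,n) ([affine_of_second_differences]). Since P_{m,n} is
    self-adjoint, |P_{m,n} h|^2 is the quadratic form of its square, and a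
    self-adjoint operator is determined by its quadratic form; comparing the
    coefficients gives P_{m,n}^2 = mA + nB + I ([weight_path_sqr]).

    It remains to see that P_{m,n} is the positive square root, i.e. that two
    positive operators with the same square coincide
    ([bop_positive_sqr_inj]). This is shown by testing on nearly maximizing
    vectors of the difference of the two operators. *)

(** * The underlying real inner product *)

Section RealInnerProduct.
Variables (R : realType) (H : hilbertType R).
Implicit Types (x y z : H) (S T P : bop H).

Definition rdot x y : R := complex.Re (inner x y).

Lemma rdotC x y : rdot x y = rdot y x.
Proof.
rewrite /rdot hermC expr0 mul1r -[X in complex.Re X = _]/((inner y x)^*)%C.
by case: (inner y x).
Qed.

Lemma rdotDl x y z : rdot (x + y) z = rdot x z + rdot y z.
Proof. by rewrite /rdot linearDl/= raddfD. Qed.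

Lemma rdotNl x z : rdot (- x) z = - rdot x z.
Proof. by rewrite /rdot linearNl/= raddfN. Qed.

Lemma rdotZl (a : R) x z : rdot (real_complex R a *: x) z = a * rdot x z.
Proof.
by rewrite /rdot linearZl_LR/=; case: (inner x z) => p q /=; rewrite mul0r subr0.
Qed.

Lemma rdotDr x y z : rdot z (x + y) = rdot z x + rdot z y.
Proof. by rewrite rdotC rdotDl !(rdotC z). Qed.

Lemma rdotNr x z : rdot z (- x) = - rdot z x.
Proof. by rewrite rdotC rdotNl rdotC. Qed.

Lemma rdotZr (a : R) x z : rdot z (real_complex R a *: x) = a * rdot z x.
Proof. by rewrite rdotC rdotZl rdotC. Qed.

Lemma rdot0l z : rdot 0 z = 0.
Proof. by rewrite -(subrr z) rdotDl rdotNl subrr. Qed.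

Lemma rdot0r z : rdot z 0 = 0.
Proof. by rewrite rdotC rdot0l. Qed.

Definition rdotE := (rdotDl, rdotDr, rdotNl, rdotNr, rdotZl, rdotZr).

Lemma rdotxx x : rdot x x = sqnorm x.
Proof. by rewrite /rdot inner_normE. Qed.

Lemma rdotxx_eq0 x : rdot x x = 0 -> x = 0.
Proof.
rewrite rdotxx => x0; apply/eqP; rewrite -normr_eq0 -sqrf_eq0 -sqnormE x0.
by rewrite eqxx.
Qed.

Lemma rdotxx_ge0 x : 0 <= rdot x x.
Proof. by rewrite rdotxx sqnorm_ge0. Qed.

Lemma rdot_CauchySchwarz x y : rdot x y ^+ 2 <= rdot x x * rdot y y.
Proof.
have [/rdotxx_eq0 ->|y0] := eqVneq (rdot y y) 0.
  by rewrite !rdot0r expr0n mulr0.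
have yy : 0 < rdot y y by rewrite lt_def y0 rdotxx_ge0.
have := rdotxx_ge0 (real_complex R (rdot y y) *: x - real_complex R (rdot x y) *: y).
rewrite !rdotE (rdotC y x) => h.
rewrite -subr_ge0 -(pmulr_rge0 _ yy); apply: le_trans h _.
by rewrite le_eqVlt; apply/orP; left; apply/eqP; ring.
Qed.

(** * Symmetric and positive operators *)

Definition symmetric_bop T := forall x y, rdot (T x) y = rdot x (T y).

(** Over the complex numbers a real quadratic form forces symmetry: polarizing
    along x + i y shows that the imaginary part of the form at that vector is, up
    to sign, the defect of symmetry for the real inner product. *)
Lemma bop_positive_symmetric T : bop_positive T -> symmetric_bop T.
Proof.
move=> T0 x y.
have im z : complex.Im (inner (T z) z) = 0 by apply: ger0_Im.
rewrite [RHS]rdotC /rdot; have := im (x + 'i%C *: y).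
rewrite !linearD/= linearDl/= linearDl/= !linearZ/= !linearZl_LR/= !linearZr_LR/=.
move: (im x) (im y).
case: (inner (T x) x) => a0 a1; case: (inner (T y) y) => b0 b1 /=.
case: (inner (T x) y) => c0 c1; case: (inner (T y) x) => d0 d1 /=.
by move=> -> ->; lra.
Qed.

Lemma bop_positive_rdot T x : bop_positive T -> 0 <= rdot (T x) x.
Proof. by move=> /(_ x); rewrite lecE => /andP[]. Qed.

(** The quadratic form at x + y recovers the cross term, both halves of which
    agree by symmetry. *)
Lemma symmetric_bop_eq S T : symmetric_bop S -> symmetric_bop T ->
  (forall x, rdot (S x) x = rdot (T x) x) -> S = T.
Proof.
move=> sS sT ST; apply/bop_eqP => x.
have E y : rdot (S x) y = rdot (T x) y.
  have := ST (x + y); rewrite !linearD/= !rdotE !ST.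
  have := sS y x; have := sT y x; rewrite !(rdotC y) => -> ->.
  lra.
apply/eqP; rewrite -subr_eq0; apply/eqP; apply: rdotxx_eq0.
by rewrite rdotDl rdotNl E subrr.
Qed.

Lemma bop_bound T :
  exists2 c : R, 0 < c & forall x, rdot (T x) (T x) <= c ^+ 2 * rdot x x.
Proof.
have [M TM] := bop_bounded T; exists (`|M| + 1) => [|x].
  by rewrite ltr_wpDl.
rewrite !rdotxx -lecR rmorphM/= rmorphXn/= !sqnormE -exprMn.
rewrite ler_sqr ?nnegrE ?mulr_ge0 ?ler0c ?addr_ge0//.
apply: le_trans (TM x) _; rewrite ler_wpM2r// lecR.
by rewrite (le_trans (ler_norm M))// lerDl.
Qed.

(** The Cauchy-Schwarz inequality of the semi-definite form <T x, y> yields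
    |T x|^2 <= |T| <T x, x>; in particular T x is small as soon as <T x, x>
    is. *)
Lemma bop_positive_bound T : bop_positive T ->
  exists2 c : R, 0 < c & forall x, rdot (T x) (T x) <= c * rdot (T x) x.
Proof.
move=> T0; have [c c0 Tc] := bop_bound T; exists c => // x.
have Tcr y : rdot (T y) y <= c * rdot y y.
  rewrite -ler_sqr ?nnegrE ?bop_positive_rdot ?mulr_ge0 ?rdotxx_ge0 ?(ltW c0)//.
  apply: le_trans (rdot_CauchySchwarz _ _) _.
  by rewrite exprMn [rdot y y ^+ 2]expr2 mulrA ler_wpM2r ?rdotxx_ge0.
(* The form at x - t T x is at most <T x, x> - 2 t |T x|^2 + c t^2 |T x|^2,
   which is smallest at t = 1 / c; the vector used is c times that one. *)
have := bop_positive_rdot (real_complex R c *: x - T x) T0.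
rewrite linearB/= linearZ/= !rdotE (bop_positive_symmetric T0 (T x) x).
have := Tcr (T x) => h1 h2; rewrite -(ler_pM2l c0).
by move: h1 h2; nra.
Qed.

(** N is the square of the operator norm; the second clause provides the
    approximate maximizers that replace a norm-attaining vector in infinite
    dimension. *)
Lemma bop_maximizing T : exists2 N : R,
  forall x, rdot (T x) (T x) <= N * rdot x x &
  forall e, 0 < e -> exists x, rdot x x <= 1 /\ N - e < rdot (T x) (T x).
Proof.
have [c c0 Tc] := bop_bound T.
pose E := [set r | exists x, rdot x x <= 1 /\ r = rdot (T x) (T x)]%classic.
have supE : has_sup E.
  split; first by exists 0, 0; rewrite linear0 !rdot0l.
  exists (c ^+ 2) => _ [x [x1 ->]]; apply: le_trans (Tc x) _.
  by rewrite ler_piMr// sqr_ge0.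
exists (sup E) => [x|e e0].
  have [/rdotxx_eq0->|x0] := eqVneq (rdot x x) 0.
    by rewrite linear0 !rdot0l mulr0.
  have xx : 0 < rdot x x by rewrite lt_def x0 rdotxx_ge0.
  pose t := (Num.sqrt (rdot x x))^-1.
  have t2 : t * t = (rdot x x)^-1.
    by rewrite -invfM -expr2 sqr_sqrtr// ltW.
  rewrite -ler_pdivrMr// mulrC -t2; apply: ub_le_sup; first by case: supE.
  exists (real_complex R t *: x); rewrite linearZ/= !rdotE !mulrA t2.
  by rewrite mulVf.
have [_ [x [x1 ->]] Nx] := sup_adherent e0 supE.
by exists x.
Qed.

(** Uniqueness of the positive square root. Put D = P - S; from P^2 = S^2 one
    gets P D = - D S and S D = - D P, hence
    <P D x, D x> + <S D x, D x> = - <(P + S) x, D^2 x>. If the norm of D were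
    sqrt N > 0, a vector x of the unit ball with |D x|^2 close to N would be
    an approximate eigenvector of D^2 for N, so that the right-hand side would
    be close to - N <(P + S) x, x> <= 0. Both terms on the left, being nonnegative, would
    then be small, hence P D x and S D x too by [bop_positive_bound], and so
    would their difference D^2 x: but |D^2 x| is at least |D x|^2. *)
Lemma bop_positive_sqr_inj P S : bop_positive P -> bop_positive S ->
  P ^+ 2 = S ^+ 2 -> P = S.
Proof.
move=> P0 S0 PS.
have PPSS x : P (P x) = S (S x).
  by have /bop_eqP/(_ x) := PS.
have sP := bop_positive_symmetric P0; have sS := bop_positive_symmetric S0.
pose D := P - S.
have DE x : D x = P x - S x by [].
have sD : symmetric_bop D by move=> x y; rewrite !DE !rdotE sP sS.
have PD x : P (D x) = - D (S x).
  by rewrite !DE linearB/= PPSS opprB.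
have SD x : S (D x) = - D (P x).
  by rewrite !DE linearB/= PPSS opprB.
(* An opaque D keeps the additivity rewrites from splitting D x. *)
clearbody D.
have [p p0 Pp] := bop_positive_bound P0.
have [s s0 Ss] := bop_positive_bound S0.
have [q q0 Qq] := bop_bound (P + S).
have [N DN Nmax] := bop_maximizing D.
suff N0 : N <= 0.
  apply/bop_eqP => x; apply/eqP; rewrite -subr_eq0 -DE; apply/eqP/rdotxx_eq0.
  apply/eqP; rewrite eq_le rdotxx_ge0 andbT (le_trans (DN x))//.
  by rewrite mulr_le0_ge0// rdotxx_ge0.
rewrite leNgt; apply/negP => N0.
(* The quantitative form of the argument: |D x|^8 <= K (N - |D x|^2)
   on the unit ball. *)
pose K := 4 * (p + s) ^+ 2 * q ^+ 2 * N.
have key x : rdot x x <= 1 -> rdot (D x) (D x) ^+ 4 <= K * (N - rdot (D x) (D x)).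
  move=> x1; set u := rdot (D x) (D x).
  have u0 : 0 <= u := rdotxx_ge0 _.
  have uN : u <= N by apply: le_trans (DN x) _; rewrite ler_piMr// ltW.
  pose v := rdot (D (D x)) (D (D x)).
  have vN : v <= N * u by exact: DN.
  have uE : rdot (D (D x)) x = u by rewrite sD.
  have uv : u ^+ 2 <= v.
    rewrite -uE; apply: le_trans (rdot_CauchySchwarz _ _) _.
    by rewrite ler_piMr// rdotxx_ge0.
  pose a := rdot (P (D x)) (D x); pose b := rdot (S (D x)) (D x).
  have a0 : 0 <= a by exact: bop_positive_rdot.
  have b0 : 0 <= b by exact: bop_positive_rdot.
  have vab : v <= 2 * (p + s) * (a + b).
    have h := Pp (D x); have k := Ss (D x).
    have : v <= 2 * rdot (P (D x)) (P (D x)) + 2 * rdot (S (D x)) (S (D x)).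
      have := rdotxx_ge0 (P (D x) + S (D x)).
      by rewrite /v (DE (D x)) !rdotE (rdotC (S (D x))); lra.
    rewrite -/a -/b in h k.
    have : 0 <= p * b by rewrite mulr_ge0// ltW.
    have : 0 <= s * a by rewrite mulr_ge0// ltW.
    lra.
  (* z measures how far x is from an eigenvector of D^2 for N. *)
  pose z := real_complex R N *: x - D (D x).
  have abz : a + b <= rdot ((P + S) x) z.
    have Q0 : 0 <= rdot (P x) x + rdot (S x) x.
      by rewrite addr_ge0// bop_positive_rdot.
    have -> : a + b = - rdot (P x) (D (D x)) - rdot (S x) (D (D x)).
      by rewrite /a /b PD SD !rdotNl !sD; lra.
    rewrite /z -[(P + S) x]/(P x + S x) !rdotE.
    have := mulr_ge0 (ltW N0) Q0; lra.
  have zz : rdot z z <= N * (N - u).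
    rewrite /z !rdotE -/v (rdotC x (D (D x))) uE.
    have : N * (N * rdot x x) <= N * N by rewrite ler_pM2l// ler_piMr// ltW.
    lra.
  have ab2 : (a + b) ^+ 2 <= q ^+ 2 * (N * (N - u)).
    apply: (@le_trans _ _ (rdot ((P + S) x) z ^+ 2)).
      by rewrite ler_sqr ?nnegrE ?(le_trans _ abz) ?addr_ge0.
    apply: le_trans (rdot_CauchySchwarz _ _) _.
    apply: ler_pM; rewrite ?rdotxx_ge0//.
    by apply: le_trans (Qq x) _; rewrite ler_piMr ?sqr_ge0.
  apply: (@le_trans _ _ (v ^+ 2)).
    by rewrite (exprM u 2 2) ler_sqr ?nnegrE ?sqr_ge0// (le_trans _ uv) ?sqr_ge0.
  apply: (@le_trans _ _ ((2 * (p + s) * (a + b)) ^+ 2)).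
    by rewrite ler_sqr ?nnegrE// ?rdotxx_ge0// !mulr_ge0 ?addr_ge0// ltW.
  rewrite exprMn /K.
  have : 0 <= (2 * (p + s)) ^+ 2 by apply: sqr_ge0.
  move=> /ler_wpM2l/(_ _ _ ab2); rewrite [(2 * _) ^+ 2]exprMn; lra.
have K0 : 0 < K.
  by rewrite /K !mulr_gt0 ?addr_gt0.
(* With |D x|^2 > N - e and e <= N / 2, the left-hand side of key is at least
   L while its right-hand side is less than K e. *)
pose L := (N / 2) ^+ 4.
have L0 : 0 < L by rewrite exprn_gt0// divr_gt0.
pose e := Num.min (N / 2) (L / K).
have e0 : 0 < e by rewrite lt_min !divr_gt0.
have [x [x1 Nx]] := Nmax e e0.
have := key x x1; apply/negP; rewrite -ltNge.
have e1 : e <= N / 2 by rewrite ge_min lexx.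
have e2 : e <= L / K by rewrite ge_min lexx orbT.
apply: (@lt_le_trans _ _ L).
  rewrite -(divfK (lt0r_neq0 K0) L) [L / K * K]mulrC ltr_pM2l//; lra.
by rewrite lerXn2r ?nnegrE ?rdotxx_ge0 ?divr_ge0 ?(ltW N0)//; lra.
Qed.

Lemma symmetric_bopD S T :
  symmetric_bop S -> symmetric_bop T -> symmetric_bop (S + T).
Proof. by move=> sS sT x y; rewrite rdotDl rdotDr sS sT. Qed.

Lemma symmetric_bopN S : symmetric_bop S -> symmetric_bop (- S).
Proof. by move=> sS x y; rewrite rdotNl rdotNr sS. Qed.

Lemma symmetric_bop1 : symmetric_bop (1 : bop H).
Proof. by []. Qed.

Lemma symmetric_bop_sqr S : symmetric_bop S -> symmetric_bop (S ^+ 2).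
Proof. by move=> sS x y; rewrite -[LHS]/(rdot (S (S x)) y) !sS. Qed.

Lemma symmetric_bopMn S k : symmetric_bop S -> symmetric_bop (S *+ k).
Proof.
move=> sS; elim: k => [x y|k IH]; last by rewrite mulrS; exact: symmetric_bopD.
by rewrite mulr0n -[LHS]/(rdot 0 y) -[RHS]/(rdot x 0) rdot0l rdot0r.
Qed.

(** * Square roots, inverses and adjoints *)

Lemma bop_sqrt_sqr P : bop_positive P -> bop_sqrt (P ^+ 2) = P.
Proof.
move=> P0; apply: xget_unique => // S [S0 SP].
exact: bop_positive_sqr_inj.
Qed.

Lemma bop_invK T : bop_invertible T -> T * bop_inv T = 1.
Proof. by move=> [S TS]; have [] := xgetI 0 TS. Qed.

Lemma bop_eq_mul_inv S T U : bop_invertible T -> S * T = U -> S = U * bop_inv T.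
Proof. by move=> /bop_invK TK <-; rewrite -mulrA TK mulr1. Qed.

Lemma bop_invertibleM S T :
  bop_invertible S -> bop_invertible T -> bop_invertible (S * T).
Proof.
move=> [S' [S'S SS']] [T' [T'T TT']]; exists (T' * S'); split.
  by rewrite mulrA -(mulrA T') S'S mulr1.
by rewrite mulrA -(mulrA S) TT' mulr1.
Qed.

(** [adjoint T] is by definition either an operator satisfying the adjoint
    relation or 0. In the second case the 2-isometry identity collapses to
    1 = 0, so the space is trivial and the relation holds anyway. *)
Lemma adjoint_rdot T : 1 - adjoint T * T - adjoint T * T
    + adjoint T * adjoint T * T * T = 0 ->
  forall x y, rdot (adjoint T x) y = rdot x (T y).
Proof.
rewrite /adjoint; case: xgetP => [S -> TS _ x y|_].
  by rewrite rdotC [RHS]rdotC /rdot TS.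
rewrite !mul0r !subr0 addr0 => /bop_eqP one0 x y.
have z0 z : z = 0 := one0 z.
by congr rdot; rewrite [LHS]z0 [RHS]z0.
Qed.

(** The diagonal identities, i = j, supply the adjoint relation for each of the
    two operators. *)
Lemma toral_rdot T1 T2 : toral_2isometry T1 T2 ->
  forall Ti Tj, [set T1; T2]%classic Ti -> [set T1; T2]%classic Tj ->
  forall x, rdot x x + rdot (Ti (Tj x)) (Ti (Tj x))
    = rdot (Ti x) (Ti x) + rdot (Tj x) (Tj x).
Proof.
move=> [_ tor] Ti Tj ti tj x.
have ai := adjoint_rdot (tor _ _ ti ti); have aj := adjoint_rdot (tor _ _ tj tj).
have /bop_eqP/(_ x) := tor _ _ ti tj.
move=> /(congr1 (fun z => rdot z x)).
rewrite -[LHS]/(rdot (x - adjoint Ti (Ti x) - adjoint Tj (Tj x)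
  + adjoint Tj (adjoint Ti (Ti (Tj x)))) x).
rewrite !rdotDl !rdotNl !ai !aj ai.
have -> : rdot ((0 : bop H) x) x = 0.
  exact: rdot0l.
lra.
Qed.

End RealInnerProduct.

(** * Double sequences with vanishing second differences *)

Lemma affine_of_second_differences (R : realFieldType) (f : nat -> nat -> R) :
  (forall m n, f m n + f m.+2 n = f m.+1 n + f m.+1 n) ->
  (forall m n, f m n + f m n.+2 = f m n.+1 + f m n.+1) ->
  (forall m n, f m n + f m.+1 n.+1 = f m.+1 n + f m n.+1) ->
  forall m n, f m n = f 0 0 + (f 1 0 - f 0 0) *+ m + (f 0 1 - f 0 0) *+ n.
Proof.
move=> f1 f2 f12.
have d1 m n : f m.+1 n - f m n = f 1 0 - f 0 0.
  elim: m => [|m IH]; last by have := f1 m n; rewrite -IH; lra.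
  by elim: n => [//|n IH]; have := f12 0 n; rewrite -IH; lra.
have d2 n : f 0 n.+1 - f 0 n = f 0 1 - f 0 0.
  by elim: n => [//|n IH]; have := f2 0 n; rewrite -IH; lra.
elim=> [|m IH] n; last by rewrite mulrSr; have := IH n; have := d1 m n; lra.
elim: n => [|n IH]; first by rewrite !mulr0n !addr0.
by rewrite mulrSr; have := d2 n; lra.
Qed.

(** * Weighted shifts *)

Section WeightedShift.
Variables (R : realType) (H : hilbertType R).
Implicit Types (W : nat -> nat -> bop H).

Lemma l2_delta_inj (i : nat * nat) : injective (@l2_delta R _ H i).
Proof.
by move=> h k /(congr1 (fun f : l2 _ H => f i)) /=; rewrite eqxx.
Qed.

Lemma rdot_l2_delta (i : nat * nat) (h : H) :
  rdot (l2_delta i h) (l2_delta i h) = rdot h h.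
Proof.
rewrite !rdotxx; rewrite {1}/sqnorm l2_sqnormE/=.
rewrite rsum_ge0E => [|j]; last exact: sqnorm_ge0.
rewrite (eq_esum (b := fun j =>
    if j \in [set i]%classic then (sqnorm h)%:E else 0%E)); last first.
  move=> j _ /=; have [->|/eqP ji] := eqVneq j i.
    by rewrite mem_set.
  by rewrite memNset// /sqnorm normr0 expr0n.
by rewrite -esum_mkcond esum_set1// lee_fin sqnorm_ge0.
Qed.

Lemma shift_weights_commute W1 W2 T1 T2 : weighted_shift W1 W2 T1 T2 ->
  T1 * T2 = T2 * T1 -> forall m n, W1 m n.+1 * W2 m n = W2 m.+1 n * W1 m n.
Proof.
move=> sh /bop_eqP comm m n; apply/bop_eqP => h.
apply: (@l2_delta_inj (m.+1, n.+1)).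
have := comm (l2_delta (m, n) h).
rewrite -[LHS]/(T1 (T2 _)) -[RHS]/(T2 (T1 _)).
by rewrite (sh m n h).1 (sh m n h).2 (sh _ _ _).1 (sh _ _ _).2.
Qed.

(** [weight_path] ends with a run of horizontal steps; the commutation relation
    pushes a final vertical step back through that run. *)
Lemma weight_pathSr W1 W2 :
  (forall m n, W1 m n.+1 * W2 m n = W2 m.+1 n * W1 m n) ->
  forall m n, W2 m n * weight_path W1 W2 m n = weight_path W1 W2 m n.+1.
Proof.
by move=> comm; elim=> [//|m IH] n; rewrite /= mulrA -comm -mulrA IH.
Qed.

Lemma weight_path_invertible W1 W2 :
  (forall m n, bop_invertible (W1 m n) /\ bop_invertible (W2 m n)) ->
  forall m n, bop_invertible (weight_path W1 W2 m n).
Proof.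
move=> inv; elim=> [|m IH] n; last exact: bop_invertibleM (inv _ _).1 _.
elim: n => [|n IH]; first by exists 1; split; rewrite mulr1.
exact: bop_invertibleM (inv _ _).2 _.
Qed.

Lemma rdot_bop_sum (A B : bop H) m n (h : H) :
  rdot ((A *+ m + B *+ n + 1) h) h
  = rdot (A h) h *+ m + rdot (B h) h *+ n + rdot h h.
Proof.
have E (C : bop H) k : rdot ((C *+ k) h) h = rdot (C h) h *+ k.
  elim: k => [|k IH]; last by rewrite !mulrSr -IH -rdotDl.
  by rewrite !mulr0n; exact: rdot0l.
by rewrite -!E -!rdotDl.
Qed.

(** The squared norms |P_{m,n} h|^2 along the orbit of e_{0,0} (x) h form a
    double sequence with vanishing second differences, with initial slopes
    <A h, h> and <B h, h> since P_{1,0} = W1_{0,0} and P_{0,1} = W2_{0,0}. *)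
Lemma weight_path_sqr W1 W2 T1 T2 : weighted_shift W1 W2 T1 T2 ->
  toral_2isometry T1 T2 -> l2_IWP W1 W2 -> forall m n,
  weight_path W1 W2 m n ^+ 2
    = (W1 0%N 0%N ^+ 2 - 1) *+ m + (W2 0%N 0%N ^+ 2 - 1) *+ n + 1.
Proof.
move=> sh tor [_ pos].
set P := weight_path W1 W2.
have comm := shift_weights_commute sh tor.1.
pose f h m n := rdot (P m n h) (P m n h).
have P1 m n : W1 m n * P m n = P m.+1 n by [].
have P2 m n : W2 m n * P m n = P m n.+1 := weight_pathSr comm m n.
have T1P m n h : T1 (l2_delta (m, n) (P m n h)) = l2_delta (m.+1, n) (P m.+1 n h).
  exact: (sh _ _ _).1.
have T2P m n h : T2 (l2_delta (m, n) (P m n h)) = l2_delta (m, n.+1) (P m n.+1 h).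
  by rewrite (sh _ _ _).2 -P2.
have in1 : [set T1; T2]%classic T1 by left.
have in2 : [set T1; T2]%classic T2 by right.
have fE h m n :
    f h m n = f h 0 0 + (f h 1 0 - f h 0 0) *+ m + (f h 0 1 - f h 0 0) *+ n.
  apply: affine_of_second_differences => {}m {}n.
  - have := toral_rdot tor in1 in1 (l2_delta (m, n) (P m n h)).
    by rewrite !T1P !rdot_l2_delta.
  - have := toral_rdot tor in2 in2 (l2_delta (m, n) (P m n h)).
    by rewrite !T2P !rdot_l2_delta.
  - have := toral_rdot tor in1 in2 (l2_delta (m, n) (P m n h)).
    by rewrite !T2P !T1P !rdot_l2_delta.
have sP m n := bop_positive_symmetric (pos m n).
have sqrP m n h : rdot ((P m n ^+ 2) h) h = f h m n by exact: sP.
have W10 : W1 0 0 = P 1 0 by exact: (esym (mulr1 _)).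
have W20 : W2 0 0 = P 0 1 by exact: (esym (mulr1 _)).
move=> m n; apply: symmetric_bop_eq => [||h].
- exact/symmetric_bop_sqr.
- apply: symmetric_bopD; last exact: symmetric_bop1.
  apply: symmetric_bopD; apply: symmetric_bopMn; apply: symmetric_bopD;
    try exact/symmetric_bopN/symmetric_bop1.
    by rewrite W10; exact/symmetric_bop_sqr.
  by rewrite W20; exact/symmetric_bop_sqr.
have sqr1 Q : rdot ((Q ^+ 2 - 1 : bop H) h) h = rdot ((Q ^+ 2) h) h - rdot h h.
  by rewrite -rdotNl -rdotDl.
by rewrite rdot_bop_sum !sqr1 W10 W20 !sqrP fE [RHS]addrC addrA.
Qed.

End WeightedShift.

(** * Formulas for the weights *)

Theorem theorem16 (R : realType) (H : hilbertType R) (sepH : separable_space H)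
    (W1 W2 : nat -> nat -> bop H) (T1 T2 : bop (l2 (nat * nat)%type H))
    (T_shift : weighted_shift W1 W2 T1 T2)
    (T_toral : toral_2isometry T1 T2)
    (W_IWP : l2_IWP W1 W2) :
  let A := W1 0%N 0%N ^+ 2 - 1 in
  let B := W2 0%N 0%N ^+ 2 - 1 in
  forall m n : nat,
    W1 m n = bop_sqrt (A *+ m.+1 + B *+ n + 1)
             * bop_inv (bop_sqrt (A *+ m + B *+ n + 1)) /\
    W2 m n = bop_sqrt (B *+ n.+1 + A *+ m + 1)
             * bop_inv (bop_sqrt (A *+ m + B *+ n + 1)).
Proof.
move=> A B m n.
have [inv pos] := W_IWP.
have sqrtE k l : bop_sqrt (A *+ k + B *+ l + 1) = weight_path W1 W2 k l.
  by rewrite -(weight_path_sqr T_shift T_toral W_IWP) bop_sqrt_sqr.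
have comm := shift_weights_commute T_shift T_toral.1.
have Pinv := weight_path_invertible inv m n.
rewrite [B *+ _ + _]addrC !sqrtE; split; apply: bop_eq_mul_inv => //.
exact: weight_pathSr.
Qed.
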